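(* Let $\mathcal V$ be a variety of algebras. Then $\mathcal V$ is congruence distributive if and only if for every algebra $\mathbf A\in\mathcal V$ and all congruences $\alpha,\beta,\gamma$ of $\mathbf A$ one has $$\alpha(\beta\circ\gamma\circ\beta)\subseteq \alpha\beta+\gamma .$$
   Context: Variety: a class of algebras of a fixed type defined by equations. A variety is congruence distributive if the congruence lattice of each of its algebras is distributive. Juxtaposition of binary relations denotes intersection (so $\alpha\beta=\alpha\cap\beta$ and $\alpha(\beta\circ\gamma\circ\beta)=\alpha\cap(\beta\circ\gamma\circ\beta)$), $\circ$ is relational composition ($a\mathrel{(R\circ S)}b$ iff there is $c$ with $a\mathrel R c\mathrel S b$), and $+$ is join in the congruence lattice. *)

(* Defs.v *)
From HB Require Import structures.
From mathcomp Require Export all_boot all_order.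
From mathcomp Require Export boolp classical_sets.

Set Implicit Arguments.
Unset Strict Implicit.
Unset Printing Implicit Defensive.

Import Order.TTheory.

Local Open Scope classical_set_scope.

(* Operation symbols are finitary but there may be any number of them;
   nullary symbols are allowed. *)
Record signature := Signature {
  symbol : Type;
  arity : symbol -> nat
}.

Record algebra (S : signature) := Algebra {
  carrier :> Type;
  carrier_inhabited : inhabited carrier;
  operation : forall f : symbol S, ('I_(arity f) -> carrier) -> carrier
}.
Arguments operation {S} _ _ _.

Inductive term (S : signature) : Type :=
| Var of nat
| App (f : symbol S) of ('I_(arity f) -> term S).
Arguments Var {S} _.

(* This instance also makes the universe of carriers contain all terms, so that
   a quantifier over algebras ranges over free algebras too. *)
Definition term_algebra (S : signature) : algebra S :=
  Algebra (inhabits (Var 0)) (@App S).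

Fixpoint eval (S : signature) (A : algebra S) (v : nat -> A) (t : term S) : A :=
  match t with
  | Var n => v n
  | App f ts => operation A f (fun i => eval v (ts i))
  end.

Definition satisfies (S : signature) (A : algebra S) (e : term S * term S) :
  Prop := forall v : nat -> A, eval v e.1 = eval v e.2.

(* Classes of algebras are plain predicates rather than [set]s: the universe of
   [algebra S] is too large for the argument of [set]. *)
Definition variety (S : signature) (V : algebra S -> Prop) : Prop :=
  exists E : set (term S * term S),
    forall A : algebra S, V A <-> (forall e, E e -> satisfies A e).

Record is_congruence (S : signature) (A : algebra S) (R : set (A * A)) :
  Prop := IsCongruence {
  cong_refl : forall x, R (x, x);
  cong_sym : forall x y, R (x, y) -> R (y, x);
  cong_trans : forall x y z, R (x, y) -> R (y, z) -> R (x, z);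
  cong_op : forall (f : symbol S) (a b : 'I_(arity f) -> A),
    (forall i, R (a i, b i)) -> R (operation A f a, operation A f b)
}.

Record congruence (S : signature) (A : algebra S) := Congruence {
  cong_rel :> set (A * A);
  congP : is_congruence cong_rel
}.

HB.instance Definition _ (S : signature) (A : algebra S) :=
  gen_eqMixin (congruence A).
HB.instance Definition _ (S : signature) (A : algebra S) :=
  gen_choiceMixin (congruence A).

Lemma cong_inj (S : signature) (A : algebra S) :
  injective (@cong_rel S A).
Proof.
move=> [r rP] [s sP] /= rs; case: _ / rs in sP *.
by rewrite (Prop_irrelevance rP sP).
Qed.

Lemma setI_is_congruence (S : signature) (A : algebra S)
    (alpha beta : congruence A) :
  is_congruence ((alpha : set (A * A)) `&` (beta : set (A * A))).
Proof.
case: alpha => a [ar as_ at_ ao]; case: beta => b [br bs bt bo] /=.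
split=> [x|x y [? ?]|x y z [? ?] [? ?]|f u v uv]; split=> //.
- exact: as_.
- exact: bs.
- exact: (at_ _ y).
- exact: (bt _ y).
- by apply: ao => i; case: (uv i).
- by apply: bo => i; case: (uv i).
Qed.

Lemma smallest_is_congruence (S : signature) (A : algebra S)
    (G : set (A * A)) :
  is_congruence (smallest (@is_congruence S A) G).
Proof.
split=> [x|x y xy|x y z xy yz|f u v uv] R [RC GR].
- exact: cong_refl.
- exact: cong_sym (xy R _).
- exact: cong_trans (xy R _) (yz R _).
- by apply: cong_op => // i; exact: uv.
Qed.

Definition cong_meet (S : signature) (A : algebra S)
    (alpha beta : congruence A) : congruence A :=
  Congruence (setI_is_congruence alpha beta).

Definition cong_join (S : signature) (A : algebra S)
    (alpha beta : congruence A) : congruence A :=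
  Congruence (smallest_is_congruence
    ((alpha : set (A * A)) `|` (beta : set (A * A)))).

Fact cong_display : Order.disp_t. Proof. exact: Order.Disp tt tt. Qed.

Section CongruenceLattice.
Variables (S : signature) (A : algebra S).
Implicit Types alpha beta gamma : congruence A.

Definition cong_le alpha beta : bool :=
  `[< (alpha : set (A * A)) `<=` (beta : set (A * A)) >].

Fact cong_le_refl : reflexive cong_le.
Proof. by move=> a; apply/asboolP. Qed.

Fact cong_le_anti : antisymmetric cong_le.
Proof.
by move=> a b /andP[/asboolP ab /asboolP ba]; apply/cong_inj/seteqP.
Qed.

Fact cong_le_trans : transitive cong_le.
Proof.
move=> b a c /asboolP ab /asboolP bc; apply/asboolP; exact: subset_trans bc.
Qed.

HB.instance Definition _ := Order.Le_isPOrder.Build cong_display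
  (congruence A) cong_le_refl cong_le_anti cong_le_trans.

Fact cong_meetP alpha beta gamma :
  (alpha <= cong_meet beta gamma)%O = (alpha <= beta)%O && (alpha <= gamma)%O.
Proof.
apply/asboolP/andP => /= [|[/asboolP ab /asboolP ac]].
  by rewrite subsetI => -[? ?]; split; apply/asboolP.
by rewrite subsetI.
Qed.

Fact cong_joinP alpha beta gamma :
  (cong_join alpha beta <= gamma)%O = (alpha <= gamma)%O && (beta <= gamma)%O.
Proof.
apply/asboolP/andP => /= [h|[/asboolP ac /asboolP bc]].
  by split; apply/asboolP => p pR; apply: h; apply: sub_gen_smallest;
    [left|right].
apply: smallest_sub; first exact: congP.
by rewrite subUset.
Qed.

HB.instance Definition _ := Order.POrder_MeetJoin_isLattice.Build cong_display
  (congruence A) cong_meetP cong_joinP.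

End CongruenceLattice.

(* Over all algebras of the variety, the law
   (alpha + beta) gamma = alpha gamma + beta gamma. *)
Definition congruence_distributive (S : signature) (V : algebra S -> Prop) :
  Prop :=
  forall A : algebra S, V A ->
    left_distributive (@Order.meet cong_display (congruence A))
                      (@Order.join cong_display (congruence A)).

(* a (R \o S) b iff a R c and c S b for some c; the library's [S \; R] takes
   its arguments in the opposite order. *)
Definition rel_comp (X : Type) (R S : set (X * X)) : set (X * X) :=
  (S \; R)%relation.

(* Main.v *)
From HB Require Import structures.
Require Import Defs.
From mathcomp Require Import generic_quotient.

(** Write [x y] for the meet of congruences, [x + y] for their join.

    Necessity is lattice theory: [beta o gamma o beta] lies in [beta + gamma],
    and distributivity gives
    [alpha (beta + gamma) = alpha beta + alpha gamma <= alpha beta + gamma].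

    For sufficiency, the inclusion is a disguised Maltsev condition.  Reading
    it in the free algebra of the variety on [x, y, z, w], with [alpha], [beta]
    and [gamma] generated by [(x, w)], by [(x, y)] and [(z, w)], and by
    [(y, z)], yields a chain of quaternary terms from [x] to [w] which turn out
    to be Day terms; hence the variety is congruence modular ([modular_law]).
    Modularity then sharpens the inclusion for a twofold composition:
    [alpha (beta o gamma) <= alpha (alpha beta + gamma)
                           = alpha beta + alpha gamma]
    ([comp_below_meets]).  Read in the free algebra on [x, y, z], this is the
    existence of Jonsson terms, and Jonsson's argument gives distributivity
    ([distributive_law]).

    No list of terms is ever written down.  A term is an element of the free
    algebra [F], which has a countable set of generators serving for both
    readings; substituting elements of an algebra [A] of the variety for its
    variables is a homomorphism from [F] to [A]; and an identity such as
    [t(x,x,z,z) = t'(x,x,z,z)] is expressed by [t] and [t'] being related by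
    the congruence of [F] that [(x, y)] and [(z, w)] generate.  Such a
    congruence is carried into any congruence of [A] relating the images of its
    generators ([extend_cong]), and a chain of terms is followed by induction
    on membership in a join ([join_ind]). *)

Set Implicit Arguments.
Unset Strict Implicit.
Unset Printing Implicit Defensive.

Import Order.TTheory.

Local Open Scope classical_set_scope.
Local Open Scope quotient_scope.

(** * Congruences, tolerances and joins *)

Section Congruences.
Variables (S : signature) (A : algebra S).
Implicit Types alpha beta gamma : congruence A.

Lemma cong_leP alpha beta :
  reflect (cong_rel alpha `<=` cong_rel beta) (alpha <= beta)%O.
Proof. exact: asboolP. Qed.

Lemma cong_joinl alpha beta : cong_rel alpha `<=` cong_rel (alpha `|` beta)%O.
Proof. by apply/cong_leP; apply: leUl. Qed.

Lemma cong_joinr alpha beta : cong_rel beta `<=` cong_rel (alpha `|` beta)%O.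
Proof. by apply/cong_leP; apply: leUr. Qed.

Definition generated_cong (G : set (A * A)) : congruence A :=
  Congruence (smallest_is_congruence G).

Lemma sub_generated (G : set (A * A)) : G `<=` cong_rel (generated_cong G).
Proof. exact: sub_gen_smallest. Qed.

Lemma generated_sub (G : set (A * A)) alpha :
  G `<=` cong_rel alpha -> cong_rel (generated_cong G) `<=` cong_rel alpha.
Proof. by apply: smallest_sub; apply: congP. Qed.

Lemma diagonal_is_congruence : is_congruence [set p : A * A | p.1 = p.2].
Proof.
split=> //= [x y z -> //|f a b ab].
by congr operation; apply: funext.
Qed.

Definition diagonal_cong : congruence A := Congruence diagonal_is_congruence.

Definition compatible (R : set (A * A)) : Prop :=
  forall (f : symbol S) (a b : 'I_(arity f) -> A),
    (forall i, R (a i, b i)) -> R (operation A f a, operation A f b).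

(** Tolerances are needed because the compositions [beta o gamma o beta], and
    their iterates that exhaust [beta + gamma], need not be transitive. *)
Record is_tolerance (R : set (A * A)) : Prop := IsTolerance {
  tol_refl : forall x, R (x, x);
  tol_sym : forall x y, R (x, y) -> R (y, x);
  tol_op : compatible R
}.

Lemma cong_tolerance alpha : is_tolerance (cong_rel alpha).
Proof. by case: (congP alpha) => ? ? _ ?. Qed.

(** Symmetry survives because the composition is palindromic. *)
Lemma tolerance_sandwich (R : set (A * A)) gamma : is_tolerance R ->
  is_tolerance (rel_comp (rel_comp R gamma) R).
Proof.
case=> rR sR oR; have [rg sg og] := cong_tolerance gamma; split.
- by move=> x; exists x; [exists x; [exact: rR|exact: rg]|exact: rR].
- move=> x y [c [b /= xb bc] /= cy].
  by exists b; [exists c; [exact: sR|exact: sg]|exact: sR].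
- move=> f u v uv.
  have /choice[c uc] i : exists c, rel_comp R gamma (u i, c) /\ R (c, v i).
    by case: (uv i) => c /= ? ?; exists c.
  have /choice[b ub] i : exists b, R (u i, b) /\ cong_rel gamma (b, c i).
    by case: (uc i) => -[b /= ? ?] _; exists b.
  exists (operation A f c); last by apply: oR => i; case: (uc i).
  exists (operation A f b); first by apply: oR => i; case: (ub i).
  by apply: og => i; case: (ub i).
Qed.

(** The transitive closure of the union of two congruences; the impredicative
    form is the induction principle wanted in [join_ind]. *)
Definition reachable alpha beta : set (A * A) := [set p |
  forall Q : A -> Prop,
    (forall s t, Q s -> cong_rel alpha (s, t) -> Q t) ->
    (forall s t, Q s -> cong_rel beta (s, t) -> Q t) ->
  Q p.1 -> Q p.2].

(** Compatibility is the point that takes work: paths between the arguments of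
    an operation may have different lengths, so the arguments are moved along
    their paths one coordinate at a time, the others standing still by
    reflexivity. *)
Lemma reachable_is_congruence alpha beta :
  is_congruence (reachable alpha beta).
Proof.
split.
- by move=> x Q.
- move=> x y xy Q Qa Qb /= Qy.
  have [ra sa _ _] := congP alpha; have [rb sb _ _] := congP beta.
  apply: (xy (fun u => Q u -> Q x)) => // [s t sx st|s t sx st] Qt.
  + by apply: sx; apply: Qa Qt _; apply: sa.
  + by apply: sx; apply: Qb Qt _; apply: sb.
- by move=> x y z xy yz Q Qa Qb /= Qx; apply: (yz Q) => //; apply: (xy Q).
- move=> f a b ab Q Qa Qb /= Qfa.
  (* The first [k] arguments have already been moved. *)
  pose mix k (i : 'I_(arity f)) := if i < k then b i else a i.
  suff Qmix k : k <= arity f -> Q (operation A f (mix k)).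
    rewrite (_ : b = mix (arity f)); first exact: Qmix.
    by apply: funext => i; rewrite /mix ltn_ord.
  elim: k => [|k IHk] ltkn.
    by rewrite (_ : mix 0 = a) //; apply: funext.
  (* The argument of rank [k] is in transit, at position [u]. *)
  pose put u (i : 'I_(arity f)) := if i == k :> nat then u else mix k i.
  have step R s t : is_congruence R -> R (s, t) ->
      R (operation A f (put s), operation A f (put t)).
    move=> RC Rst; apply: (cong_op RC) => i; rewrite /put.
    by case: ifP => // _; apply: (cong_refl RC).
  have := ab (Ordinal ltkn) (fun u => Q (operation A f (put u))).
  rewrite /= (_ : put (a _) = mix k); last first.
    apply: funext => i; rewrite /put; case: eqP => // ik.
    rewrite /mix ik ltnn; congr a; exact: val_inj.
  rewrite (_ : put (b _) = mix k.+1); last first.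
    apply: funext => i; rewrite /put /mix ltnS [i <= k]leq_eqVlt.
    case: eqP => //= ik; congr b; exact: val_inj.
  apply; [| |exact: IHk (ltnW ltkn)] => s t Qs st.
  + by apply: Qa Qs _; apply: step st; apply: congP.
  + by apply: Qb Qs _; apply: step st; apply: congP.
Qed.

(** Membership in a join as an induction along a path of steps in either
    congruence; every later use of a join goes through this principle. *)
Lemma join_ind alpha beta (Q : A -> Prop) (x y : A) :
  cong_rel (alpha `|` beta)%O (x, y) ->
  (forall s t, Q s -> cong_rel alpha (s, t) -> Q t) ->
  (forall s t, Q s -> cong_rel beta (s, t) -> Q t) ->
  Q x -> Q y.
Proof.
have /cong_leP sub :
    (alpha `|` beta <= Congruence (reachable_is_congruence alpha beta))%O.
  rewrite leUx; apply/andP; split; apply/cong_leP.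
  + by case=> s t st R Ra Rb /= Rs; apply: Ra Rs st.
  + by case=> s t st R Ra Rb /= Rs; apply: Rb Rs st.
by move=> /sub xy Qa Qb; apply: (xy Q).
Qed.

End Congruences.

(** * Free algebras of a variety *)

Lemma eval_compatible (S : signature) (A : algebra S) (R : set (A * A))
    (v w : nat -> A) (t : term S) :
  compatible R -> (forall n, R (v n, w n)) -> R (eval v t, eval w t).
Proof. by move=> Rop vw; elim: t => //= f ts IH; apply: Rop. Qed.

(** Evaluation in the term algebra is substitution. *)
Lemma eval_subst (S : signature) (A : algebra S) (v : nat -> A)
    (sigma : nat -> term_algebra S) (t : term S) :
  eval v (eval sigma t) = eval (fun n => eval v (sigma n)) t.
Proof.
by elim: t => //= f ts IH; congr operation; apply: funext => i; apply: IH.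
Qed.

HB.instance Definition _ (S : signature) := gen_eqMixin (term S).
HB.instance Definition _ (S : signature) := gen_choiceMixin (term S).

Definition identity_of (S : signature) (V : algebra S -> Prop) :
    rel (term S) :=
  fun s t => `[< forall A, V A -> satisfies A (s, t) >].

Section FreeAlgebra.
Variables (S : signature) (V : algebra S -> Prop).

Lemma identity_refl : reflexive (identity_of V).
Proof. by move=> t; apply/asboolP. Qed.

Lemma identity_sym : symmetric (identity_of V).
Proof.
by move=> s t; apply/asboolP/asboolP => st A VA v; apply/esym/st.
Qed.

Lemma identity_trans : transitive (identity_of V).
Proof.
move=> t s u /asboolP st /asboolP tu; apply/asboolP => A VA v.
by rewrite [LHS]st //; apply: tu.
Qed.

Canonical identity_equiv :=
  EquivRel (identity_of V) identity_refl identity_sym identity_trans.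

Definition free_carrier := {eq_quot identity_equiv}.

(** Well-definedness of evaluation on classes: a representative differs from
    the original term only by an identity of the class [V]. *)
Lemma eval_repr (A : algebra S) (v : nat -> A) (t : term S) : V A ->
  eval v (repr (\pi_free_carrier t)) = eval v t.
Proof.
move=> VA.
have /asboolP/(_ A VA v) // : identity_of V (repr (\pi_free_carrier t)) t.
by apply/eqmodP; rewrite reprK.
Qed.

Definition free_algebra : algebra S :=
  @Algebra S free_carrier (inhabits (\pi_free_carrier (Var 0)))
    (fun f ts => \pi_free_carrier (App (fun i => repr (ts i)))).

Definition gen (n : nat) : free_algebra := \pi_free_carrier (Var n).

Lemma free_eval (v : nat -> free_algebra) (t : term S) :
  eval v t = \pi_free_carrier
    (eval (fun n => repr (v n : free_carrier) : term_algebra S) t).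
Proof.
elim: t => [n|f ts IH] /=; first by rewrite reprK.
apply/eqmodP/asboolP => A VA w /=; congr operation; apply: funext => i.
by rewrite IH eval_repr.
Qed.

(** An equation of [V] holds in the free algebra because its substitution
    instances are again identities of [V]. *)
Lemma free_in_variety : variety V -> V free_algebra.
Proof.
case=> E EV; apply/EV => e Ee v; rewrite !free_eval.
apply/eqmodP/asboolP => A VA w; rewrite /= !eval_subst.
by move/EV: VA => /(_ e Ee); apply.
Qed.

Definition extend (A : algebra S) (v : nat -> A) (t : free_algebra) : A :=
  eval v (repr (t : free_carrier)).

Lemma extend_gen (A : algebra S) (v : nat -> A) (n : nat) : V A ->
  extend v (gen n) = v n.
Proof. exact: eval_repr. Qed.

Lemma extend_op (A : algebra S) (v : nat -> A) (f : symbol S)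
    (ts : 'I_(arity f) -> free_algebra) : V A ->
  extend v (operation free_algebra f ts) =
  operation A f (fun i => extend v (ts i)).
Proof. exact: eval_repr. Qed.

Lemma preimage_is_congruence (A : algebra S) (VA : V A) (v : nat -> A)
    (alpha : congruence A) :
  is_congruence [set p : free_algebra * free_algebra |
    cong_rel alpha (extend v p.1, extend v p.2)].
Proof.
case: (congP alpha) => ra sa ta oa; split=> /= [x|x y|x y z|f a b ab].
- exact: ra.
- exact: sa.
- exact: ta.
- by rewrite !extend_op //; apply: oa.
Qed.

Definition preimage_cong (A : algebra S) (VA : V A) (v : nat -> A)
    (alpha : congruence A) : congruence free_algebra :=
  Congruence (preimage_is_congruence VA v alpha).

(** The substitute for computing with identities: a congruence generated in the
    free algebra lies in the preimage of any congruence that relates the images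
    of its generating pairs.  With the diagonal as [alpha] it says that terms
    related by that congruence become equal after the substitution [v]. *)
Lemma extend_cong (A : algebra S) (v : nat -> A) (alpha : congruence A)
    (G : set (free_algebra * free_algebra)) (s t : free_algebra) : V A ->
  (forall p, G p -> cong_rel alpha (extend v p.1, extend v p.2)) ->
  cong_rel (generated_cong G) (s, t) ->
  cong_rel alpha (extend v s, extend v t).
Proof.
move=> VA Galpha st.
exact: (generated_sub (alpha := preimage_cong VA v alpha) Galpha st).
Qed.

End FreeAlgebra.

(** * The inclusion implies modularity *)

Definition sandwich_inclusion (S : signature) (V : algebra S -> Prop) : Prop :=
  forall (A : algebra S), V A ->
  forall alpha beta gamma : congruence A,
    cong_rel alpha `&` rel_comp (rel_comp beta gamma) beta `<=`
    cong_rel ((alpha `&` beta) `|` gamma)%O.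

Section Sufficiency.
Variables (S : signature) (V : algebra S -> Prop).
Hypotheses (hV : variety V) (incl : sandwich_inclusion V).

Let F := free_algebra V.
Let VF : V F := free_in_variety hV.

(** Generators beyond the listed ones are sent to [x], so that two assignments
    with the same first value agree there. *)
Definition assign (A : Type) (x : A) (xs : seq A) (n : nat) : A :=
  nth x (x :: xs) n.

Section Day.
Variables (A : algebra S) (VA : V A) (alpha gamma theta : congruence A).
Variable Gamma : set (A * A).
Hypotheses (GammaT : is_tolerance Gamma) (ga : (gamma <= alpha)%O)
  (gt : (gamma <= theta)%O)
  (aGt : cong_rel alpha `&` Gamma `<=` cong_rel theta).

(** The inclusion, assumed for congruences only, extends to a tolerance [Gamma]
    in the outer places, once [gamma <= alpha].  For
    [a Gamma b gamma c Gamma d] with [a alpha d], follow the images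
    [t(a,b,c,d)] of the elements [t] on the path from [x] to [w] in the free
    algebra.  All of them, and all [t(a,a,d,d)], are [alpha]-related to [a].
    On a [gamma]-step they move inside [gamma], hence inside [theta].  On the
    other steps [t(a,a,d,d)] does not change, and it is [Gamma]- and
    [alpha]-related to [t(a,b,c,d)], so the move is inside [theta] again. *)
Lemma tolerance_step :
  cong_rel alpha `&` rel_comp (rel_comp Gamma gamma) Gamma `<=` cong_rel theta.
Proof.
case=> a d [/= ad [c [b /= ab bc] /= cd]].
have [ra sa ta _] := congP alpha; have [rt _ tt _] := congP theta.
have [rG sG oG] := GammaT.
have abc := (elimT (cong_leP _ _) ga) _ bc.
have tbc := (elimT (cong_leP _ _) gt) _ bc.
pose x : F := gen V 0; pose y : F := gen V 1.
pose z : F := gen V 2; pose w : F := gen V 3.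
pose fa := generated_cong [set (x, w)].
pose fb := generated_cong [set (x, y); (z, w)].
pose fg := generated_cong [set (y, z)].
have xw : cong_rel ((fa `&` fb) `|` fg)%O (x, w).
  apply: incl => //; split; first exact: sub_generated.
  exists z; last by apply: sub_generated; right.
  by exists y; apply: sub_generated; [left|].
pose v := assign a [:: b; c; d]; pose v' := assign a [:: a; d; d].
pose h : F -> A := extend v; pose h' : F -> A := extend v'.
have hh' s : Gamma (h s, h' s).
  apply: eval_compatible => // -[|[|[|[|n]]]] //=; try exact: rG.
  exact: sG.
(* Every congruence of the path is carried into [alpha], by [h] as by [h']. *)
have fah s t : cong_rel fa (s, t) -> cong_rel alpha (h s, h t).
  by apply: extend_cong => // _ ->; rewrite /= !extend_gen.
have fgh s t : cong_rel fg (s, t) -> cong_rel alpha (h s, h t).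
  by apply: extend_cong => // _ ->; rewrite /= !extend_gen.
have fah' s t : cong_rel fa (s, t) -> cong_rel alpha (h' s, h' t).
  by apply: extend_cong => // _ ->; rewrite /= !extend_gen.
have fgh' s t : cong_rel fg (s, t) -> cong_rel alpha (h' s, h' t).
  by apply: extend_cong => // _ ->; rewrite /= !extend_gen.
have fbh' s t : cong_rel fb (s, t) -> h' s = h' t.
  by apply: (extend_cong (alpha := diagonal_cong A)) => // _ [->|->];
    rewrite /= !extend_gen.
have fgt s t : cong_rel fg (s, t) -> cong_rel theta (h s, h t).
  by apply: extend_cong => // _ ->; rewrite /= !extend_gen.
pose Q s := [/\ cong_rel alpha (a, h s), cong_rel alpha (a, h' s) &
  cong_rel theta (a, h s)].
suff [_ _] : Q w by rewrite /h extend_gen.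
apply: (join_ind (Q := Q) xw) => [s t [as_ as' ths] [/= sta stb]|
                                  s t [as_ as' ths] stg|].
- have at_ : cong_rel alpha (a, h t) by apply: ta as_ _; apply: fah.
  have at' : cong_rel alpha (a, h' t) by apply: ta as' _; apply: fah'.
  split=> //; apply: (tt _ (h s)) => //; apply: (tt _ (h' s)).
    by apply: aGt; split=> //; apply: ta as'; apply: sa.
  rewrite (fbh' _ _ stb); apply: aGt; split; last exact: sG.
  by apply: ta at_; apply: sa.
- split.
  + by apply: ta as_ _; apply: fgh.
  + by apply: ta as' _; apply: fgh'.
  + by apply: tt ths _; apply: fgt.
- by rewrite /Q /h /h' !extend_gen.
Qed.

End Day.

(** Starting from [beta], the tolerances [Gamma o gamma o Gamma] grow to exhaust
    [beta + gamma], and [tolerance_step] keeps their intersection with [alpha]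
    below the right-hand side. *)
Lemma modular_law (A : algebra S) (alpha beta gamma : congruence A) : V A ->
  (gamma <= alpha)%O ->
  (alpha `&` (beta `|` gamma) <= (alpha `&` beta) `|` gamma)%O.
Proof.
move=> VA ga; apply/cong_leP => -[p q] [pqa pqbg].
set theta := (_ `|` _)%O.
pose good Gamma := [/\ is_tolerance Gamma, cong_rel beta `<=` Gamma &
  cong_rel alpha `&` Gamma `<=` cong_rel theta].
suff [Gamma [_ _ aGt] Gpq] : exists2 Gamma, good Gamma & Gamma (p, q).
  by apply: aGt.
have enlarge Gamma : good Gamma ->
    good (rel_comp (rel_comp Gamma gamma) Gamma).
  case=> GT bG aGt; split; first exact: tolerance_sandwich.
    move=> [s t] st; exists s; last exact: bG.
    exists s; [exact: (tol_refl GT)|exact: (tol_refl (cong_tolerance gamma))].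
  apply: tolerance_step => //; exact: leUr.
apply: (join_ind (Q := fun q => exists2 Gamma, good Gamma & Gamma (p, q)) pqbg).
- move=> s t [Gamma GG ps] st.
  exists (rel_comp (rel_comp Gamma gamma) Gamma); first exact: enlarge.
  case: GG => GT bG _; exists s; last exact: bG.
  exists s => //; exact: (tol_refl (cong_tolerance gamma)).
- move=> s t [Gamma GG ps] st.
  exists (rel_comp (rel_comp Gamma gamma) Gamma); first exact: enlarge.
  case: GG => GT _ _; exists t; last exact: (tol_refl GT).
  by exists s.
- exists (cong_rel beta); last exact: (tol_refl (cong_tolerance beta)).
  split=> //; [exact: cong_tolerance|
    exact: (@cong_joinl _ _ (alpha `&` beta)%O)].
Qed.

(** * Modularity and the inclusion imply distributivity *)

(** The inclusion puts [alpha (beta o gamma)] below [alpha beta + gamma], hence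
    below [alpha (gamma + alpha beta)]; the modular law, available since
    [alpha beta <= alpha], distributes the outer [alpha]. *)
Lemma comp_below_meets (A : algebra S) (alpha beta gamma : congruence A) :
  V A ->
  cong_rel alpha `&` rel_comp beta gamma `<=`
  cong_rel ((alpha `&` beta) `|` (alpha `&` gamma))%O.
Proof.
move=> VA [p q] [pqa [r pr rq]].
have /cong_leP mod :=
  @modular_law A alpha gamma (alpha `&` beta)%O VA (leIl _ _).
rewrite joinC; apply: mod; split=> //.
rewrite joinC; apply: incl => //; split=> //.
by exists q; [exists r|exact: (tol_refl (cong_tolerance beta))].
Qed.

(** Jonsson's argument.  For [a alpha c] with [(a, c)] in [beta + gamma], each
    [t] on the path from [x] to [z] in the free algebra satisfies
    [t(a,u,c) alpha a] for every [u].  Moving [u] from [a] to [c] along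
    [beta + gamma] therefore stays inside [alpha beta + alpha gamma], so
    [t(a,a,c)] and [t(a,c,c)] are interchangeable modulo that join; steps of one
    kind on the path preserve [t(a,a,c)], steps of the other kind [t(a,c,c)]. *)
Lemma distributive_law (A : algebra S) (alpha beta gamma : congruence A) :
  V A ->
  (alpha `&` (beta `|` gamma) <= (alpha `&` beta) `|` (alpha `&` gamma))%O.
Proof.
move=> VA; apply/cong_leP => -[a c] [ac bgac].
set theta := (_ `|` _)%O.
have [ra sa ta _] := congP alpha; have [rt st tt _] := congP theta.
pose x : F := gen V 0; pose y : F := gen V 1; pose z : F := gen V 2.
pose fa := generated_cong [set (x, z)].
pose fb := generated_cong [set (x, y)].
pose fg := generated_cong [set (y, z)].
have xz : cong_rel ((fa `&` fb) `|` (fa `&` fg))%O (x, z).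
  apply: comp_below_meets => //; split; first exact: sub_generated.
  by exists y; apply: sub_generated.
pose h u : F -> A := extend (assign a [:: u; c]).
have fah u s t : cong_rel fa (s, t) -> cong_rel alpha (h u s, h u t).
  by apply: extend_cong => // _ ->; rewrite /= !extend_gen.
have fbh s t : cong_rel fb (s, t) -> h a s = h a t.
  by apply: (extend_cong (alpha := diagonal_cong A)) => // _ ->;
    rewrite /= !extend_gen.
have fgh s t : cong_rel fg (s, t) -> h c s = h c t.
  by apply: (extend_cong (alpha := diagonal_cong A)) => // _ ->;
    rewrite /= !extend_gen.
have move_mid (delta : congruence A) t u u' :
    (forall u, cong_rel alpha (a, h u t)) -> cong_rel delta (u, u') ->
    cong_rel (alpha `&` delta)%O (h u t, h u' t).
  move=> at_ uu'; split; first by apply: ta (at_ u'); apply: sa.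
  have [rd _ od] := cong_tolerance delta.
  by apply: eval_compatible => // -[|[|[|n]]] //=; apply: rd.
have ends t : (forall u, cong_rel alpha (a, h u t)) ->
    cong_rel theta (h a t, h c t).
  move=> at_.
  apply: (join_ind (Q := fun u => cong_rel theta (h a t, h u t)) bgac) => //.
  + move=> u u' hu uu'; apply: tt hu _; apply: cong_joinl.
    exact: move_mid.
  + move=> u u' hu uu'; apply: tt hu _; apply: cong_joinr.
    exact: move_mid.
pose Q s := [/\ forall u, cong_rel alpha (a, h u s),
  cong_rel theta (a, h a s) & cong_rel theta (a, h c s)].
suff [_ _] : Q z by rewrite /h extend_gen.
apply: (join_ind (Q := Q) xz).
- move=> s t [as_ hs _] [sta stb].
  have at_ u : cong_rel alpha (a, h u t) by apply: ta (as_ u) _; apply: fah.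
  rewrite (fbh _ _ stb) in hs.
  by split=> //; apply: tt hs _; apply: ends.
- move=> s t [as_ _ hs] [sta stg].
  have at_ u : cong_rel alpha (a, h u t) by apply: ta (as_ u) _; apply: fah.
  rewrite (fgh _ _ stg) in hs.
  by split=> //; apply: tt hs _; apply: st; apply: ends.
- by split=> [u||]; rewrite /h extend_gen.
Qed.

End Sufficiency.

Theorem theorem1 (S : signature) (V : algebra S -> Prop) (hV : variety V) :
  congruence_distributive V <->
  forall (A : algebra S), V A ->
  forall alpha beta gamma : congruence A,
    cong_rel alpha `&` rel_comp (rel_comp beta gamma) beta `<=`
    cong_rel ((alpha `&` beta) `|` gamma)%O.
Proof.
split=> [distr A VA alpha beta gamma [a d] [/= ad [c [b /= ab bc] /= cd]]
        |incl A VA beta gamma alpha].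
  have le : ((beta `|` gamma) `&` alpha <= (alpha `&` beta) `|` gamma)%O.
    by rewrite distr // (meetC alpha); apply: leU2 => //; apply: leIl.
  apply: (elimT (cong_leP _ _) le); split=> //=.
  have [_ _ tr _] := congP (beta `|` gamma)%O.
  apply: (tr _ c); last exact: cong_joinl.
  by apply: (tr _ b); [exact: cong_joinl|exact: cong_joinr].
apply: le_anti; apply/andP; split.
  rewrite ![(_ `&` alpha)%O]meetC; exact: (distributive_law hV incl).
rewrite leUx !lexI leIr !andbT leIr andbT.
by rewrite !leIxl ?leUl ?leUr.
Qed.
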